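(* There exists a set $B\subseteq\mathbb{N}$ such that both $B$ and $B'$ are Besicovitch and $d^*(\mathcal{M}_{B'}\setminus\mathcal{M}_B)>0$.
   Context: $\mathbb{N}=\{1,2,\dots\}$. For $B\subseteq\mathbb{N}$ let $\mathcal{M}_B=\bigcup_{b\in B}b\mathbb{Z}$ be its set of multiples. For $A\subseteq\mathbb{Z}$, the natural density is $d(A)=\lim_{n\to\infty}\frac1n|A\cap[1,n]|$ (if it exists), the upper Banach density is $d^*(A)=\limsup_{n\to\infty}\sup_{k}\frac1n|A\cap[k+1,k+n]|$, and the logarithmic density is $\delta(A)=\lim_{n\to\infty}\frac{1}{\ln n}\sum_{1\le k\le n,\,k\in A}\frac1k$; $\delta(\mathcal{M}_B)$ exists for every $B\subseteq\mathbb{N}$ (Davenport--Erdős). $B$ is Besicovitch if $d(\mathcal{M}_B)$ exists. $B$ is Behrend if $B\subseteq\mathbb{N}\setminus\{1\}$ and $\delta(\mathcal{M}_B)=1$. $B$ is taut if $\delta(\mathcal{M}_{B\setminus\{b\}})<\delta(\mathcal{M}_B)$ for every $b\in B$. $B^{prim}=B\setminus\bigcup_{k\ge2}kB$. For $c\in\mathbb{N}$ and $A\subseteq\mathbb{N}$, $cA=\{ca:a\in A\}$. Tautification: put $C(B)=\{c\in\mathbb{N}: cA\subseteq B\text{ for some Behrend set }A\}$; the tautification of $B$ is $B'=(B\cup C(B))^{prim}$. (Equivalently, $B'$ is the unique taut set whose Mirsky measure equals that of $B$, where the Mirsky measure of $B$ is the shift-invariant measure on $\{0,1\}^{\mathbb{Z}}$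 for which $\mathbf{1}_{\mathbb{Z}\setminus\mathcal{M}_B}$ is quasi-generic along any sequence realizing the lower density of $\mathcal{M}_B$.) *)

(* Defs.v *)
(* MathComp-Analysis *)
From HB Require Import structures.
From mathcomp Require Import all_boot all_order all_algebra.
From mathcomp Require Import all_classical all_reals all_analysis.
Set Implicit Arguments.
Unset Strict Implicit.
Unset Printing Implicit Defensive.
Import Order.TTheory GRing.Theory Num.Theory.
Import numFieldNormedType.Exports.
Local Open Scope classical_set_scope.
Local Open Scope ring_scope.

(* Sets of positive integers are represented by B : set nat that do not
   contain 0; [positive] states this. *)
Definition positive (B : set nat) : Prop := B `<=` [set n | (0 < n)%N].

Definition multiples (B : set nat) : set int :=
  \bigcup_(b in B) [set z : int | (b%:Z %| z)%Z].

Definition dilate (c : nat) (A : set nat) : set nat := [set (c * a)%N | a in A].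

Definition count_window (A : set int) (k : int) (n : nat) : nat :=
  (\sum_(1 <= i < n.+1) ((k + i%:Z)%R \in A))%N.

(* At n = 0, and at n = 1 for [log_mean], the division is by 0 and has the
   value 0; this does not affect limits at infinity. *)
Definition window_mean (R : realType) (A : set int) (k : int) (n : nat) : R :=
  (count_window A k n)%:R / n%:R.

Definition log_mean (R : realType) (A : set int) (n : nat) : R :=
  (ln (n%:R : R))^-1 * \sum_(1 <= k < n.+1 | k%:Z \in A) (k%:R)^-1.

Definition has_density (R : realType) (A : set int) (d : R) : Prop :=
  window_mean R A 0 n @[n --> \oo] --> d.

Definition has_log_density (R : realType) (A : set int) (d : R) : Prop :=
  log_mean R A n @[n --> \oo] --> d.

Definition upper_banach_density (R : realType) (A : set int) : \bar R :=
  limn_esup (fun n => ereal_sup (range (fun k : int => (window_mean R A k n)%:E))).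

Definition besicovitch (R : realType) (B : set nat) : Prop :=
  exists d : R, has_density (multiples B) d.

Definition behrend (R : realType) (B : set nat) : Prop :=
  [/\ positive B, ~ B 1%N & has_log_density (multiples B) (1 : R)].

Definition prim (B : set nat) : set nat :=
  B `\` \bigcup_(k in [set k | (2 <= k)%N]) dilate k B.

(* The set C(B). *)
Definition behrend_scales (R : realType) (B : set nat) : set nat :=
  [set c | (0 < c)%N /\ exists2 A : set nat, behrend R A & dilate c A `<=` B].

Definition tautification (R : realType) (B : set nat) : set nat :=
  prim (B `|` behrend_scales R B).

(* Main.v *)
(* Let C be a union of windows (K n, K n + n] placed so sparsely that the sum of
   1/c over C is at most 1/2, with K n divisible by every element of the earlier
   windows, and let B = { k c : c in C, k >= 2 }.  Since { k : k >= 2 } is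
   Behrend, C is contained in the set of scales of B, and in fact M_{B'} = M_C.
   As the reciprocals of C are summable, M_C is approximated in density by
   periodic sets, and so is M_B, from which at most finitely many positive
   multiples of each c are missing.  Finally K n + j (1 <= j <= n) lies in
   M_C \ M_B as soon as j is not in M_C, and at least half of the j are not. *)
Require Import Defs.
From mathcomp Require Import all_boot all_order all_algebra.
From mathcomp Require Import all_classical all_reals all_analysis.
From mathcomp Require Import ring lra zify.
Import Order.TTheory GRing.Theory Num.Theory.
Import numFieldNormedType.Exports.
Local Open Scope classical_set_scope.
Local Open Scope ring_scope.

(** * Summable reciprocals and the density of a set of multiples *)

Definition recip_sum (R : realType) (C : set nat) (m n : nat) : R :=
  \sum_(m <= c < n | c \in C) (c%:R)^-1.

(** Convergence in Cauchy form: the part of [C] beyond some [M] is negligible. *)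
Definition recip_summable (R : realType) (C : set nat) : Prop :=
  forall e : R, 0 < e -> exists M, forall n, recip_sum R C M n <= e.

Lemma multiplesP (B : set nat) (i : nat) :
  reflect (exists2 b, B b & (b %| i)%N) (i%:Z \in multiples B).
Proof.
apply: (iffP idP) => [/set_mem [b Bb /=]|[b Bb bi]].
  by rewrite dvdzE /= => bi; exists b.
by apply: mem_set; exists b => //=; rewrite dvdzE.
Qed.

Lemma count_window0E (A : set int) (n : nat) :
  count_window A 0 n = (\sum_(1 <= i < n.+1) (i%:Z \in A))%N.
Proof. by rewrite /count_window; apply: eq_bigr => i _; rewrite add0r. Qed.

(** Union bound: each point of [A] missed by [A0] is charged to some [c >= M], and [c] has
    [n %/ c <= n / c] multiples in [[1, n]]. *)
Lemma count_window_le (R : realType) (A A0 : set int) (C : set nat) (M n : nat) :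
  (forall i : nat, (0 < i <= n)%N -> i%:Z \in A -> i%:Z \notin A0 ->
     exists2 c, C c & (M <= c)%N /\ (c %| i)%N) ->
  (count_window A 0 n)%:R <=
    (count_window A0 0 n)%:R + n%:R * recip_sum R C M n.+1.
Proof.
move=> H.
have le1 : (count_window A 0 n <= count_window A0 0 n +
    \sum_(M <= c < n.+1 | c \in C) n %/ c)%N.
  rewrite !count_window0E.
  under [X in (_ <= _ + X)%N]eq_bigr do rewrite divn_count_dvd.
  rewrite (exchange_big_nat _ _ _ _ _ (fun c => c \in C) xpredT) /= -big_split /=.
  rewrite big_nat [leqRHS]big_nat; apply: leq_sum => i /andP[i0 iN].
  case: (boolP (i%:Z \in A)) => // iA; case: (boolP (i%:Z \in A0)) => [_|iA0].
    exact: leq_addr.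
  have [|c Cc [Mc ci]] := H i _ iA iA0; first by rewrite i0.
  rewrite (big_rem c) /=; last first.
    by rewrite mem_index_iota Mc ltnS (leq_trans (dvdn_leq i0 ci)).
  by rewrite mem_set // ci.
apply: le_trans (_ : _ <= (count_window A0 0 n +
    \sum_(M <= c < n.+1 | c \in C) n %/ c)%N%:R) _; first by rewrite ler_nat.
rewrite natrD lerD2l natr_sum /recip_sum mulr_sumr; apply: ler_sum => c _.
(* For [c = 0] both sides are 0 by the default values of division and inverse. *)
have [->|c0] := posnP c; first by rewrite divn0 invr0 mulr0.
by rewrite ler_pdivlMr ?ltr0n // -natrM ler_nat leq_divM.
Qed.

(** [rho] is the share of one period. Full periods contribute exactly [rho * P] each; the incomplete
    one leaves a difference of two numbers in [[0, P]]. *)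
Lemma count_window_periodic (R : realType) (A : set int) (P : nat) :
  (0 < P)%N -> (forall i : nat, ((i + P)%N%:Z \in A) = (i%:Z \in A)) ->
  exists rho : R, forall n,
    `|(count_window A 0 n)%:R - rho * n%:R| <= P%:R.
Proof.
move=> P0 per; pose f n := count_window A 0 n.
have fE n : f n = (\sum_(0 <= i < n) (i.+1%:Z \in A))%N.
  by rewrite /f count_window0E big_add1.
have fP n : f (n + P)%N = (f n + f P)%N.
  elim: n => [|n IH]; first by rewrite add0n {2}/f count_window0E big_geq.
  rewrite addSn !fE !big_nat_recr //= -!fE IH.
  by rewrite -addSn per addnAC.
have fle n : (f n <= n)%N.
  rewrite fE; apply: leq_trans (_ : _ <= \sum_(0 <= i < n) 1)%N _.
    by apply: leq_sum => i _; case: (_ \in _).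
  by rewrite sum_nat_const_nat subn0 muln1.
have fq q r : f (q * P + r)%N = (q * f P + f r)%N.
  elim: q => [|q IH]; first by rewrite !mul0n.
  by rewrite !mulSn -addnA (addnC P) fP IH; lia.
exists ((f P)%:R / P%:R) => n.
rewrite -/(f n).
move: (n %/ P)%N (n %% P)%N (divn_eq n P) (ltn_pmod n P0) => q r -> rP.
rewrite fq !natrD !natrM.
have PR : (P%:R : R) != 0 by rewrite pnatr_eq0 -lt0n.
have -> : q%:R * (f P)%:R + (f r)%:R
   - (f P)%:R / P%:R * (q%:R * P%:R + r%:R)
   = (f r)%:R - (f P)%:R / P%:R * r%:R :> R by field.
have a1 : 0 <= (f P)%:R / P%:R :> R by rewrite divr_ge0.
have a2 : (f P)%:R / P%:R <= 1 :> R.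
  by rewrite ler_pdivrMr ?ltr0n // mul1r ler_nat.
have b1 : (f r)%:R <= P%:R :> R.
  by rewrite ler_nat (leq_trans (fle _)) // ltnW.
have b2 : r%:R <= P%:R :> R by rewrite ler_nat ltnW.
have b3 : 0 <= r%:R :> R by [].
have b4 : 0 <= (f r)%:R :> R by [].
have ar : (f P)%:R / P%:R * r%:R <= r%:R :> R by rewrite ler_piMl.
have ar0 : 0 <= (f P)%:R / P%:R * r%:R :> R by rewrite mulr_ge0.
by rewrite ler_norml; apply/andP; split; lra.
Qed.

(** After division by [n] the means are eventually within [e] of some [rho], for every [e], so they
    form a Cauchy sequence. *)
Lemma has_density_approx (R : realType) (A : set int) :
  (forall e : R, 0 < e -> exists rho K : R, forall n,
     `|(count_window A 0 n)%:R - rho * n%:R| <= e * n%:R + K) ->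
  exists d : R, has_density A d.
Proof.
move=> H.
suff : cvg (window_mean R A 0 n @[n --> \oo]) by move=> /cvg_ex[d dP]; exists d.
apply: cauchy_cvg; apply: cauchy_exP => e e0.
have [|rho [K HK]] := H (e / 3); first by rewrite divr_gt0.
exists rho.
change (\forall n \near \oo, ball rho e (window_mean R A 0 n)).
near=> n.
have n0 : 0 < n%:R :> R by rewrite ltr0n; near: n; exists 1%N.
have Kn : K * 3 / e <= n%:R by near: n; exact: nbhs_infty_ger.
rewrite /ball /= /window_mean distrC.
have -> : (count_window A 0 n)%:R / n%:R - rho
    = ((count_window A 0 n)%:R - rho * n%:R) / n%:R.
  by field; rewrite gt_eqF.
rewrite normrM normfV (gtr0_norm n0) ltr_pdivrMr //.
apply: le_lt_trans (HK n) _.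
have : K * 3 <= n%:R * e by rewrite -ler_pdivrMr.
nra.
Unshelve. all: by end_near.
Qed.

(** The multiples of the [c < M] in [C] are periodic modulo [M!]. The rest of [C] adds at most
    [e * n] points, and passing to [X] loses only points below [M]. This applies to [C] itself and
    to its proper multiples. *)
Lemma besicovitch_approx (R : realType) (C X : set nat) :
  positive C -> recip_summable R C -> multiples X `<=` multiples C ->
  (forall M i c, C c -> (c < M)%N -> (M <= i)%N -> (c %| i)%N ->
     i%:Z \in multiples X) ->
  besicovitch R X.
Proof.
move=> C0 sC XC CX; apply: has_density_approx => e e0.
have [M HM] := sC e e0.
pose CM := [set c | C c /\ (c < M)%N].
have [||rho Hrho] := @count_window_periodic R (multiples CM) M`!.
- exact: fact_gt0.
- move=> i; apply/multiplesP/multiplesP => -[c [Cc cM] ci]; exists c => //.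
    by move: ci; rewrite dvdn_addl // dvdn_fact // C0 //= ltnW.
  by rewrite dvdn_addl // dvdn_fact // C0 //= ltnW.
exists rho, (M`!%:R + M%:R) => n.
have up : (count_window (multiples X) 0 n)%:R <=
    (count_window (multiples CM) 0 n)%:R + n%:R * recip_sum R C M n.+1.
  apply: count_window_le => i _ /set_mem /XC /mem_set /multiplesP[c Cc ci] nCM.
  exists c => //; split => //; rewrite leqNgt; apply/negP => cM.
  by move/multiplesP: nCM; apply; exists c.
have lo : (count_window (multiples CM) 0 n <= count_window (multiples X) 0 n + M)%N.
  rewrite !count_window0E.
  have [nM|Mn] := leqP n.+1 M.
    apply: leq_trans (leq_addl _ _).
    apply: leq_trans (_ : _ <= \sum_(1 <= i < n.+1) 1)%N _.
      by apply: leq_sum => i _; case: (_ \in _).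
    by rewrite sum_nat_const_nat; lia.
  (* Cutting [[1, n]] at [M] requires [M >= 1]; for [M = 0] the set [CM] is empty. *)
  have [M0|M0] := posnP M.
    rewrite big1 // => i _; case: multiplesP => // -[c [_]]; rewrite M0 //.
  have sp (Y : set nat) : (\sum_(1 <= i < n.+1) (i%:Z \in multiples Y) =
      \sum_(1 <= i < M) (i%:Z \in multiples Y) +
      \sum_(M <= i < n.+1) (i%:Z \in multiples Y))%N.
    by rewrite -big_cat_nat // ltnW.
  rewrite !sp.
  have h1 : (\sum_(1 <= i < M) (i%:Z \in multiples CM) <= M)%N.
    apply: leq_trans (_ : _ <= \sum_(1 <= i < M) 1)%N _.
      by apply: leq_sum => i _; case: (_ \in _).
    by rewrite sum_nat_const_nat; lia.
  have h2 : (\sum_(M <= i < n.+1) (i%:Z \in multiples CM)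
     <= \sum_(M <= i < n.+1) (i%:Z \in multiples X))%N.
    rewrite big_nat [leqRHS]big_nat; apply: leq_sum => i /andP[Mi _].
    case: multiplesP => // -[c [Cc cM] ci]; rewrite (CX M i c) //.
  lia.
have {}lo : (count_window (multiples CM) 0 n)%:R <=
   (count_window (multiples X) 0 n)%:R + M%:R :> R by rewrite -natrD ler_nat.
have n0 : 0 <= n%:R :> R by [].
have tl : n%:R * recip_sum R C M n.+1 <= e * n%:R by rewrite mulrC ler_wpM2r.
have F0 : 0 <= M`!%:R :> R by [].
have M0 : 0 <= M%:R :> R by [].
have en : 0 <= e * n%:R by rewrite mulr_ge0 // ltW.
have := Hrho n; rewrite !ler_norml => /andP[h1 h2]; apply/andP; split; lra.
Qed.

(** * Harmonic sums and a Behrend set *)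

(** The inductive step is [ln (1 + x) <= x] at [x = 1 / (n + 1)]. *)
Lemma ln_le_harmonic (R : realType) (n : nat) :
  ln (n.+1%:R) <= \sum_(1 <= k < n.+1) (k%:R)^-1 :> R.
Proof.
elim: n => [|n IH]; first by rewrite ln1 big_geq.
rewrite big_nat_recr //=.
have n0 : 0 < n.+1%:R :> R by rewrite ltr0n.
have -> : n.+2%:R = n.+1%:R * (1 + n.+1%:R^-1) :> R.
  by rewrite mulrDr mulr1 mulfV ?gt_eqF // -natr1.
have i0 : 0 < n.+1%:R^-1 :> R by rewrite invr_gt0.
rewrite lnM ?posrE // ?addr_gt0 //; apply: lerD => //.
by apply: le_ln1Dx; rewrite (lt_trans _ i0).
Qed.

(** The inductive step is [ln (1 + x) <= x] at [x = - 1 / (n + 2)]. *)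
Lemma harmonic_le_ln (R : realType) (n : nat) :
  \sum_(1 <= k < n.+2) (k%:R)^-1 <= 1 + ln (n.+1%:R) :> R.
Proof.
elim: n => [|n IH]; first by rewrite ln1 big_nat1 invr1 addr0.
rewrite big_nat_recr //=.
have n0 : 0 < n.+2%:R :> R by rewrite ltr0n.
have n1 : 0 < n.+1%:R :> R by rewrite ltr0n.
have i1 : n.+2%:R^-1 < 1 :> R by rewrite invf_lt1 // ltr1n.
have E : n.+1%:R = n.+2%:R * (1 - n.+2%:R^-1) :> R.
  by rewrite mulrBr mulr1 mulfV ?gt_eqF // -[n.+2%:R]natr1 addrK.
have : ln n.+1%:R = ln n.+2%:R + ln (1 - n.+2%:R^-1) :> R.
  by rewrite -lnM -?E // posrE // subr_gt0.
have := @le_ln1Dx R (- n.+2%:R^-1); rewrite ltrN2 => /(_ i1).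
by move=> h1 h2; rewrite (le_trans (lerD IH (lexx _))) // h2 addrA -[leLHS]addrA gerDl -lerBrDr sub0r.
Qed.

Lemma cvg_ln_natr_pinfty (R : realType) : ln (n%:R : R) @[n --> \oo] --> +oo.
Proof.
apply/cvgryPge => A; near=> n.
have nA : expR A <= n%:R by near: n; exact: nbhs_infty_ger.
by rewrite -(expRK A) ler_ln ?posrE ?expR_gt0 // (lt_le_trans _ nA) ?expR_gt0.
Unshelve. all: by end_near.
Qed.

(** The only positive non-multiple is 1, so the logarithmic mean is [(H - 1) / ln n] with [H] the
    harmonic sum, squeezed between [1 - 1 / ln n] and 1. *)
Lemma behrend_ge2 (R : realType) : behrend R [set a | (2 <= a)%N].
Proof.
split => //; first by move=> a /= /ltnW.
have E n : log_mean R (multiples [set a | (2 <= a)%N]) n.+1 =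
    (ln (n.+1%:R : R))^-1 * (\sum_(1 <= k < n.+2) (k%:R)^-1 - 1).
  rewrite /log_mean; congr (_ * _).
  rewrite big_ltn_cond // [in RHS]big_ltn // invr1.
  rewrite ifF; last by apply/multiplesP => -[b /= b2]; rewrite dvdn1; lia.
  rewrite addrAC subrr add0r big_nat_cond [RHS]big_nat; apply: eq_bigl => k.
  have [/andP[k2 _]|//] := boolP (2 <= k < _)%N.
  by apply/multiplesP; exists k.
apply: (@squeeze_cvgr _ _ _ _ (fun n => 1 - (ln (n%:R : R))^-1) (fun=> 1)).
- near=> n.
  have l0 : 1 <= ln (n%:R : R).
    by near: n; apply: (cvgryPge _).1; exact: cvg_ln_natr_pinfty.
  have n0 : (0 < n)%N by near: n; exists 1%N.
  have nE : n = n.-1.+1 by rewrite prednK.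
  move: l0; rewrite nE; move: (n.-1) => m l0; rewrite E.
  have l1 : 0 < ln (m.+1%:R : R) by rewrite (lt_le_trans _ l0).
  have ln0 : ln (m.+1%:R : R) != 0 by rewrite gt_eqF.
  rewrite [in X in X && _](_ : 1 - _ = (ln (m.+1%:R))^-1 * (ln m.+1%:R - 1)); last by field.
  rewrite ler_pM2l ?invr_gt0 // [X in _ && (_ <= X)](_ : 1 = (ln m.+1%:R)^-1 * ln m.+1%:R); last by field.
  rewrite ler_pM2l ?invr_gt0 //.
  have := harmonic_le_ln R m; have := ln_le_harmonic R m.+1.
  have : ln m.+1%:R <= ln m.+2%:R :> R by rewrite ler_ln ?posrE ?ltr0n // ler_nat.
  by move=> *; apply/andP; split; lra.
- rewrite -[X in _ --> X]subr0; apply: cvgB; first exact: cvg_cst.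
  apply/gtr0_cvgV0; last exact: cvg_ln_natr_pinfty.
  have h : \forall n \near \oo, 1 <= ln (n%:R : R).
    by apply: (cvgryPge _).1; exact: cvg_ln_natr_pinfty.
  by apply: filterS h => n h; rewrite (lt_le_trans _ h).
- exact: cvg_cst.
Unshelve. all: by end_near.
Qed.

(** * Behrend scales over a set with summable reciprocals *)

(* If c divides 1 + P t, then c is prime to P, so t is determined by s = t %/ c,
   and 1 + P t >= c (1 + P s). *)
Lemma recip_sum_multiples_ap_coprime (R : realType) (c P T : nat) :
  (0 < c)%N ->
  \sum_(0 <= t < T | (c %| 1 + P * t)%N) ((1 + P * t)%N%:R)^-1 <=
    (c%:R)^-1 * \sum_(0 <= t < T) ((1 + P * t)%N%:R)^-1 :> R.
Proof.
move=> c0; rewrite !big_mkord mulr_sumr.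
pose p (t : 'I_T) := Ordinal (leq_ltn_trans (leq_div t c) (ltn_ord t)).
rewrite (partition_big p xpredT) //=; apply: ler_sum => s _.
have [t0 /= /andP[ct0 pt0]|no] := pickP [pred t : 'I_T | (c %| 1 + P * t)%N && (p t == s)];
  last first.
  by rewrite big_pred0 ?mulr_ge0.
rewrite (big_pred1 t0) => [|t]; last first.
  apply/idP/eqP => [/andP[ct pt]|->]; last by rewrite ct0.
  apply: val_inj => /=.
  have q : (t %/ c = t0 %/ c)%N.
    by move/eqP: pt => /(congr1 val) /= ->; move/eqP: pt0 => /(congr1 val).
  have coP : coprime c P.
    apply: coprime_dvdl ct0 _.
    by rewrite /coprime gcdnC addnC mulnC gcdnMDl gcdn1.
  suff r : (t = t0 %[mod c])%N by rewrite (divn_eq t c) q r -divn_eq.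
  apply/eqP; have [le|/ltnW le] := leqP t0 t.
    rewrite eqn_mod_dvd // -(Gauss_dvdr _ coP) mulnBr -(subnDl 1).
    by rewrite dvdn_sub.
  rewrite eq_sym eqn_mod_dvd // -(Gauss_dvdr _ coP) mulnBr -(subnDl 1).
  by rewrite dvdn_sub.
rewrite -invfM lef_pV2 ?posrE ?mulr_gt0 ?ltr0n // -natrM ler_nat.
have -> : (s = t0 %/ c :> nat)%N by move/eqP: pt0 => <-.
(* [c] divides [1 + P * (t0 %% c)], which is therefore at least [c]. *)
have E : (1 + P * t0 = 1 + P * (t0 %% c) + c * (P * (t0 %/ c)))%N.
  by rewrite {1}(divn_eq t0 c); lia.
rewrite E mulnDr muln1 leq_add2r dvdn_leq //.
by move: ct0; rewrite E dvdn_addl // dvdn_mulr.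
Qed.

(** Dividing [c] and [d] by their gcd [g] removes [d] from the divisibility; the factor becomes
    [g / c <= d / c]. *)
Lemma recip_sum_multiples_ap (R : realType) (c d P T : nat) :
  (0 < c)%N -> (0 < d)%N ->
  \sum_(0 <= t < T | (c %| d * (1 + P * t))%N) ((1 + P * t)%N%:R)^-1 <=
    d%:R / c%:R * \sum_(0 <= t < T) ((1 + P * t)%N%:R)^-1 :> R.
Proof.
move=> c0 d0; set g := gcdn c d.
have g0 : (0 < g)%N by rewrite gcdn_gt0 c0.
have cE : (c = c %/ g * g)%N by rewrite divnK // dvdn_gcdl.
have dE : (d = d %/ g * g)%N by rewrite divnK // dvdn_gcdr.
have c'0 : (0 < c %/ g)%N by rewrite divn_gt0 // dvdn_leq // dvdn_gcdl.
have co : coprime (c %/ g) (d %/ g).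
  rewrite /coprime -(eqn_pmul2r g0) mul1n muln_gcdl -cE -dE //.
under eq_bigl => t.
  rewrite {1}cE {1}dE mulnAC dvdn_pmul2r // Gauss_dvdr //.
  over.
apply: le_trans (recip_sum_multiples_ap_coprime _ _ _ _ c'0) _.
apply: ler_wpM2r; first by apply: sumr_ge0.
rewrite ler_pdivlMr ?ltr0n // {2}cE natrM mulKf ?pnatr_eq0 -?lt0n //.
by rewrite ler_nat dvdn_leq // dvdn_gcdr.
Qed.

(** [1 + P * t] is the first element of the block [(P * t, P * (t + 1)]]. *)
Lemma sum_ap_le (R : realType) (F : nat -> R) (P T : nat) :
  (0 < P)%N -> (forall k, 0 <= F k) ->
  \sum_(0 <= t < T) F (1 + P * t)%N <= \sum_(1 <= k < (P * T).+1) F k.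
Proof.
move=> P0 F0; elim: T => [|T IH]; first by rewrite muln0 !big_geq.
rewrite big_nat_recr //= [leRHS](@big_cat_nat _ _ _ (P * T).+1) //=; last first.
  by rewrite ltnS leq_mul2l leqnSn orbT.
apply: lerD => //; rewrite big_ltn ?ltnS ?ltn_mul2l ?P0 //= add1n lerDl.
by apply: sumr_ge0.
Qed.

(* If no element of C divides d, take P = M! with M large: an m = 1 + P t with
   d m in M_C is such that d m is a multiple of some c >= M in C, and this
   happens for at most half of these m in the logarithmic sense.  The others are
   not in M_A, so that M_A has upper logarithmic density less than 1. *)
Lemma behrend_scale_multiple (R : realType) (C A : set nat) (d : nat) :
  positive C -> recip_summable R C -> behrend R A -> (0 < d)%N ->
  (forall a, A a -> exists2 c, C c & (c %| d * a)%N) ->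
  exists2 c, C c & (c %| d)%N.
Proof.
move=> C0 sC [_ _ dA] d0 HA; apply: contrapT => nCd.
have dR : 0 < d%:R :> R by rewrite ltr0n.
(* This bound absorbs the factor [d] of [recip_sum_multiples_ap] and leaves one half. *)
have [|M HM] := sC (2 * d%:R)^-1; first by rewrite invr_gt0 mulr_gt0.
pose P := M`!; have P0 : (0 < P)%N by exact: fact_gt0.
have PR : 0 < P%:R :> R by rewrite ltr0n.
pose m t := (1 + P * t)%N.
pose S T : R := \sum_(0 <= t < T) ((m t)%:R)^-1.
pose F k : R := if k%:Z \in multiples A then 0 else (k%:R)^-1.
have F0 k : 0 <= F k by rewrite /F; case: ifP.
have good T : S T <= 2 * \sum_(0 <= t < T) F (m t).
  set N := (d * m T).+1.
  have le1 : S T <= \sum_(0 <= t < T) F (m t) +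
      \sum_(0 <= t < T) \sum_(M <= c < N | (c \in C) && (c %| d * m t)%N) ((m t)%:R)^-1.
    rewrite -big_split /= /S [leLHS]big_nat [leRHS]big_nat.
    apply: ler_sum => t /andP[_ tT]; rewrite /F; case: multiplesP => [[a Aa am]|_].
      rewrite add0r; have [c Cc cda] := HA a Aa.
      have cdm : (c %| d * m t)%N by rewrite (dvdn_trans cda) // dvdn_pmul2l.
      have dm0 : (0 < d * m t)%N by rewrite muln_gt0 d0.
      (* A [c < M] would divide [P], hence also [d = d * m t - d * P * t]. *)
      have Mc : (M <= c)%N.
        rewrite leqNgt; apply/negP => cM; apply: nCd; exists c => //.
        have cP : (c %| P)%N by rewrite dvdn_fact // C0 //= ltnW.
        by move: cdm; rewrite /m mulnDr muln1 dvdn_addl // mulnCA dvdn_mulr.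
      rewrite (big_rem c) /=; last first.
        rewrite mem_index_iota Mc ltnS (leq_trans (dvdn_leq dm0 cdm)) //.
        by rewrite leq_mul2l leq_add2l leq_mul2l (ltnW tT) !orbT.
      by rewrite mem_set // cdm /= lerDl sumr_ge0.
    by rewrite lerDl sumr_ge0.
  rewrite (exchange_big_dep_nat (fun c => c \in C)) /= in le1; last first.
    by move=> ? ? _ _ _ /andP[].
  have le2 : \sum_(M <= c < N | c \in C)
      \sum_(0 <= t < T | (c \in C) && (c %| d * m t)%N) ((m t)%:R)^-1 <=
      \sum_(M <= c < N | c \in C) (c%:R)^-1 * (d%:R * S T).
    apply: ler_sum => c cC; rewrite cC /= mulrA [_ * d%:R]mulrC.
    by apply: recip_sum_multiples_ap => //; apply: C0; exact: set_mem.
  rewrite -mulr_suml in le2.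
  have S0 : 0 <= d%:R * S T by rewrite mulr_ge0 ?sumr_ge0.
  have le3 := ler_wpM2r S0 (HM N).
  have e3 : (2 * d%:R)^-1 * (d%:R * S T) = S T / 2 by field; rewrite gt_eqF.
  rewrite e3 in le3; rewrite /recip_sum in le3.
  lra.
have lower T : ln T.+1%:R <= 2 * P%:R * \sum_(1 <= k < (P * T).+1) F k.
  apply: le_trans (ln_le_harmonic R T) _.
  (* Since [m t <= P * (t + 1)], the harmonic sum is recovered at the cost of a factor [P]. *)
  have h : \sum_(1 <= k < T.+1) (k%:R)^-1 <= P%:R * S T.
    rewrite /S mulr_sumr big_add1 /=; apply: ler_sum => t _.
    have mt : 0 < (m t)%:R :> R by rewrite ltr0n.
    rewrite -[leLHS]mul1r ler_pdivrMr ?ltr0n // mulrAC ler_pdivlMr // mul1r.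
    by rewrite -natrM ler_nat /m mulnS leq_add2r.
  apply: le_trans h _; rewrite [2 * _]mulrC -mulrA ler_pM2l //.
  apply: le_trans (good T) _; rewrite ler_pM2l //.
  exact: sum_ap_le.
have logE n : log_mean R (multiples A) n = (ln (n%:R : R))^-1 *
    (\sum_(1 <= k < n.+1) (k%:R)^-1 - \sum_(1 <= k < n.+1) F k).
  rewrite /log_mean; congr (_ * _); rewrite big_mkcond -sumrB /=.
  by apply: eq_bigr => k _; rewrite /F; case: ifP; rewrite ?subr0 ?subrr.
(* With [L = ln n] and [G] the sum of [F] up to [n], density 1 forces [G < 1 + e * L <= 2 * e * L],
   whereas [lower] gives [G >= L / (4 * P) = 4 * e * L]. *)
pose e : R := (16 * P%:R)^-1.
have e0 : 0 < e by rewrite invr_gt0 mulr_gt0.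
have [N _ HN] : \forall n \near \oo,
    1 - e < log_mean R (multiples A) n /\ e^-1 <= ln (n%:R : R).
  near=> n; split; near: n; last first.
    by apply: (cvgryPge _).1; exact: cvg_ln_natr_pinfty.
  by apply: (cvgr_gt _ dA); rewrite ltrBlDr ltrDl.
(* [T >= N] makes [HN] apply to [n]; [T >= P] gives [ln n <= 2 * ln (T + 1)]. *)
pose T := maxn N P; pose n := (P * T)%N.
have PT : (P <= T)%N by rewrite leq_maxr.
have T0 : (0 < T)%N by exact: leq_trans PT.
have n0 : (0 < n)%N by rewrite muln_gt0 P0.
have [|h1 h2] := HN n.
  by rewrite /= (leq_trans (leq_maxl N P)) // leq_pmull.
have lnn : ln (n%:R : R) <= 2 * ln T.+1%:R.
  rewrite natrM lnM ?posrE ?ltr0n // mulr2n mulrDl mul1r.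
  by apply: lerD; rewrite ler_ln ?posrE ?ltr0n // ler_nat // ltnW.
have up : \sum_(1 <= k < n.+1) (k%:R)^-1 <= 1 + ln (n%:R : R).
  by have := harmonic_le_ln R n.-1; rewrite prednK.
have l0 : 0 < ln (n%:R : R) by rewrite (lt_le_trans _ h2) // invr_gt0.
have lw := lower T; rewrite -/n in lw.
rewrite logE mulrC ltr_pdivlMr // in h1.
move: lnn up l0 lw h1 h2; rewrite /e invrK.
set L := ln _; set H := \sum_(1 <= k < n.+1) _; set G := \sum_(1 <= k < n.+1) F k.
set L' := ln _ => lnn up l0 lw h1 h2.
have eL : 1 <= e * L by rewrite -ler_pdivrMl // mulr1 /e invrK.
have G1 : e * L * 4 <= G.
  rewrite -(ler_pM2l PR); apply: le_trans (_ : L / 4 <= _).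
    by rewrite le_eqVlt; apply/orP; left; apply/eqP; rewrite /e; field; rewrite gt_eqF.
  lra.
rewrite -/e mulrBl mul1r in h1.
lra.
Unshelve. all: by end_near.
Qed.

(** * Multiples of the tautification *)

(** Descent: a non-primitive element is a proper multiple of another element, which is smaller by
    positivity. *)
Lemma multiples_prim (X : set nat) :
  positive X -> multiples (prim X) = multiples X.
Proof.
move=> X0; apply/seteqP; split => [z [b [Xb _] bz]|z [b Xb bz]]; first by exists b.
suff [p pX pb] : exists2 p, prim X p & (p %| b)%N.
  by exists p => //=; rewrite dvdzE (dvdn_trans pb) // -dvdzE.
elim/ltn_ind: b Xb {bz} => b IH Xb.
have [pb|npb] := pselect (prim X b); first by exists b.
have [k /= k2 [c Xc cb]] : (\bigcup_(k in [set k | (2 <= k)%N]) dilate k X) b.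
  by apply: contrapT => nb; apply: npb.
have [|p pX pc] := IH c _ Xc.
  by rewrite -cb ltn_Pmull // X0.
by exists p => //; rewrite (dvdn_trans pc) // -cb dvdn_mull.
Qed.

(** For [C = windows] this is the set [B] of the theorem. *)
Definition proper_multiples (C : set nat) : set nat :=
  \bigcup_(k in [set k | (2 <= k)%N]) dilate k C.

Lemma proper_multiples_positive (C : set nat) :
  positive C -> positive (proper_multiples C).
Proof. by move=> C0 _ [k /= k2 [c /C0 /= c0 <-]] /=; rewrite muln_gt0 c0 ltnW. Qed.

(** Each [c] in [C] is a scale through the Behrend set of all [a >= 2]. Conversely, if [b] is a
    scale through [A], every [b * a] is a multiple of an element of [C], hence so is [b] by
    [behrend_scale_multiple]. *)
Lemma multiples_tautification (R : realType) (C : set nat) :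
  positive C -> recip_summable R C ->
  multiples (tautification R (proper_multiples C)) = multiples C.
Proof.
move=> C0 sC; rewrite multiples_prim; last first.
  move=> x [|[]//]; exact: proper_multiples_positive.
apply/seteqP; split => z [b Xb bz]; last first.
  exists b => //; right; split; first exact: C0.
  exists [set a | (2 <= a)%N]; first exact: behrend_ge2.
  by move=> _ [a /= a2 <-]; exists a => //=; exists b => //; rewrite mulnC.
suff [c Cc cb] : exists2 c, C c & (c %| b)%N.
  by exists c => //=; rewrite dvdzE (dvdn_trans cb) // -dvdzE.
case: Xb => [[k _ [c Cc <-]]|[b0 [A bA AB]]]; first by exists c => //; exact: dvdn_mull.
apply: behrend_scale_multiple sC bA b0 _ => // a Aa.
have [|k _ [c Cc cE]] := AB (b * a)%N; first by exists a.
by exists c => //; rewrite -cE dvdn_mull.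
Qed.

(** * A lower bound for the upper Banach density *)

(** The limsup is an infimum of suprema over neighbourhoods of infinity, each of which contains some
    positive length. *)
Lemma upper_banach_density_ge (R : realType) (A : set int) (e : R) :
  (forall n, (0 < n)%N -> exists k, e <= window_mean R A k n) ->
  (e%:E <= upper_banach_density R A)%E.
Proof.
move=> H; rewrite /upper_banach_density /limn_esup limf_esupE.
apply: le_ereal_inf_tmp => _ [V [N _ NV] <-].
have [k ek] := H N.+1 isT.
apply: (@le_trans _ _ (ereal_sup (range (fun k : int => (window_mean R A k N.+1)%:E)))).
  apply: (@le_trans _ _ (window_mean R A k N.+1)%:E); first by rewrite lee_fin.
  by apply: ereal_sup_ubound; exists k.
by apply: ereal_sup_ubound; exists N.+1 => //; apply: NV => /=.
Qed.

(** * The sparse windows and their reciprocal sums *)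

(** The factorial gives divisibility by all integers up to the end of the previous window; the power
    of 4 makes the reciprocals small. *)
Fixpoint window_start (n : nat) : nat :=
  if n is m.+1 then (4 ^ m.+2 * (window_start m + m)`!)%N else 4%N.

Lemma window_startS (n : nat) :
  window_start n.+1 = (4 ^ n.+2 * (window_start n + n)`!)%N.
Proof. by []. Qed.

Arguments window_start : simpl never.

(** The window for [n = 0] is empty. *)
Definition windows : set nat :=
  [set c | exists n, (window_start n < c <= window_start n + n)%N].

Lemma window_start_ge (n : nat) : (4 ^ n.+1 <= window_start n)%N.
Proof. by case: n => [|n] //; rewrite window_startS leq_pmulr // fact_gt0. Qed.

(** Once [c] divides a start it is at most that start, so it divides the next factorial as well. *)
Lemma dvdn_window_start (m n c : nat) :
  (m < n)%N -> (0 < c <= window_start m + m)%N -> (c %| window_start n)%N.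
Proof.
elim: n => // n IH; rewrite ltnS leq_eqVlt => /orP[/eqP<-|mn] cm.
  by rewrite window_startS dvdn_mull // dvdn_fact.
have cn := IH mn cm; rewrite window_startS dvdn_mull // dvdn_fact //.
case/andP: cm => -> _ /=; rewrite (leq_trans (dvdn_leq _ cn)) ?leq_addr //.
by rewrite (leq_trans _ (window_start_ge n)) // expn_gt0.
Qed.

Lemma window_start_lt (m n : nat) :
  (m < n)%N -> (window_start m + m <= window_start n)%N.
Proof.
move=> mn; have n0 : (0 < window_start n)%N.
  by rewrite (leq_trans _ (window_start_ge n)) // expn_gt0.
apply: dvdn_leq => //; apply: dvdn_window_start mn _.
by rewrite leqnn andbT addn_gt0 (leq_trans _ (window_start_ge m)) // expn_gt0.
Qed.

Lemma window_start_id (n : nat) : (n <= window_start n)%N.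
Proof.
apply: leq_trans (window_start_ge n); apply: ltnW.
by apply: leq_trans (ltn_expl n (isT : (1 < 4)%N)) _; rewrite leq_pexp2l.
Qed.

Lemma windows_positive : positive windows.
Proof. by move=> c [n /andP[nc _]] /=; exact: leq_trans nc. Qed.

Lemma recip_sum_le_width (R : realType) (C : set nat) (a b N : nat) :
  recip_sum R C a b <= recip_sum R C a (maxn b N).
Proof.
have [ab|ba] := leqP a b; last first.
  by rewrite {1}/recip_sum big_geq ?sumr_ge0 // ltnW.
rewrite {2}/recip_sum (@big_cat_nat _ _ _ b) ?leq_maxl //= lerDl.
exact: sumr_ge0.
Qed.

(** Only window [n] meets this range: [n <= 2 ^ n] elements, each with reciprocal at most
    [1 / 4 ^ (n + 1)]. *)
Lemma recip_sum_window (R : realType) (n : nat) :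
  recip_sum R windows (window_start n).+1 (window_start n.+1).+1 <=
    (4 * 2 ^+ n)^-1.
Proof.
have K0 : (0 < window_start n)%N.
  by rewrite (leq_trans _ (window_start_ge n)) // expn_gt0.
have KR : 0 < (window_start n)%:R :> R by rewrite ltr0n.
have le1 := window_start_lt _ _ (ltnSn n).
rewrite /recip_sum (@big_cat_nat _ _ _ (window_start n + n).+1) ?ltnS ?leq_addr //=.
rewrite [X in _ + X]big_nat_cond [X in _ + X]big_pred0 ?addr0; last first.
  move=> c; apply/negP => /andP[/andP[c1 c2]] /set_mem[m /andP[mc cm]].
  have [mn|nm|mn] := ltngtP m n.
  - have := window_start_lt _ _ mn; lia.
  - have nm' : (window_start n.+1 <= window_start m)%N.
      move: nm; rewrite leq_eqVlt => /orP[/eqP->//|nm].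
      by have := window_start_lt _ _ nm; lia.
    lia.
  - by subst m; lia.
apply: (@le_trans _ _ (\sum_((window_start n).+1 <= c < (window_start n + n).+1)
    ((window_start n)%:R)^-1)).
  rewrite big_mkcond big_nat [leRHS]big_nat; apply: ler_sum => c /andP[c1 _].
  case: ifP => _; last by rewrite invr_ge0.
  by rewrite lef_pV2 ?posrE ?ltr0n ?ler_nat; lia.
rewrite sumr_const_nat subSS addKn -[leLHS]mulr_natl ler_pdivrMr //.
rewrite [leRHS]mulrC ler_pdivlMr ?mulr_gt0 ?exprn_gt0 //.
rewrite -natrX -!natrM ler_nat (leq_trans _ (window_start_ge n)) //.
by rewrite expnS mulnCA leq_mul2l /= (expnMn 2 2) leq_mul2r (ltnW (ltn_expl _ _)) ?orbT.
Qed.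

Lemma recip_sum_windows (R : realType) (m n : nat) :
  recip_sum R windows (window_start m).+1 n <= (2 * 2 ^+ m)^-1.
Proof.
(* The geometric bounds of the single windows telescope. *)
have K j : recip_sum R windows (window_start m).+1 (window_start (m + j)).+1
    <= (2 * 2 ^+ m)^-1 - (2 * 2 ^+ (m + j))^-1.
  elim: j => [|j IH]; first by rewrite addn0 /recip_sum big_geq // subrr.
  have mj : (window_start m <= window_start (m + j))%N.
    case: j {IH} => [|j]; first by rewrite addn0.
    by have := window_start_lt m (m + j.+1); lia.
  have jj : (window_start (m + j) <= window_start (m + j).+1)%N.
    by have := window_start_lt _ _ (ltnSn (m + j)); lia.
  rewrite addnS /recip_sum (@big_cat_nat _ _ _ (window_start (m + j)).+1) ?ltnS //=.
  apply: le_trans (lerD IH (recip_sum_window R _)) _.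
  rewrite exprS -addrA lerD2l le_eqVlt; apply/orP; left; apply/eqP.
  have : (2 : R) ^+ (m + j) != 0 by rewrite expf_neq0.
  by move: (_ ^+ _) => x x0; field.
apply: le_trans (recip_sum_le_width R windows _ n (window_start (m + n)).+1) _.
rewrite (maxn_idPr _); last first.
  by rewrite (leq_trans (leq_addl m n)) // leqW // window_start_id.
apply: le_trans (K n) _; rewrite gerDl oppr_le0 invr_ge0 mulr_ge0 // exprn_ge0 //.
Qed.

Lemma windows_recip_summable (R : realType) : recip_summable R windows.
Proof.
move=> e e0.
have [m me] : exists m, e^-1 <= 2 ^+ m :> R.
  have [m _ H] := nbhs_infty_ger (e^-1); exists m.
  apply: le_trans (H m _) _ => //=.
  by rewrite -natrX ler_nat ltnW // ltn_expl.
exists (window_start m).+1 => n; apply: le_trans (recip_sum_windows R m n) _.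
rewrite -[e]invrK lef_pV2 ?posrE ?mulr_gt0 ?exprn_gt0 ?invr_gt0 //.
by rewrite (le_trans me) // ler_peMl ?exprn_ge0 // ler1n.
Qed.

(** No window has an element up to [window_start 0], so the tail bound for [m = 0] covers the whole
    sum. *)
Lemma recip_sum_windows_half (R : realType) (n : nat) :
  recip_sum R windows 0 n <= 2^-1.
Proof.
apply: le_trans (recip_sum_le_width R windows _ n (window_start 0).+1) _.
rewrite /recip_sum (@big_cat_nat _ _ _ (window_start 0).+1) ?leq_maxr //=.
rewrite big_nat_cond big_pred0 ?add0r; last first.
  move=> c; apply/negP => /andP[/andP[_ c4]] /set_mem[m /andP[mc _]].
  case: m mc => [|m]; first by rewrite ltnNge -ltnS c4.
  by have := window_start_lt 0 m.+1 isT; lia.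
by apply: le_trans (recip_sum_windows R 0 _) _; rewrite expr0 mulr1.
Qed.

(** Suppose [k * c] divides [window_start n + j], with [k >= 2] and [c] in window [m]. If [m < n],
    then [c] divides [window_start n], hence [j]. If [m >= n], then [c > window_start n >= n], and
    [2 * c] is too large. *)
Lemma window_elt_notin (n j : nat) :
  (0 < j <= n)%N -> j%:Z \notin multiples windows ->
  (window_start n + j)%N%:Z \in
    multiples windows `\` multiples (proper_multiples windows).
Proof.
move=> /andP[j0 jn] jC; apply: mem_set; split.
  exists (window_start n + j)%N; last by rewrite /= dvdzz.
  by exists n; rewrite -addn1 !leq_add2l j0.
move=> /mem_set /multiplesP[_ [k /= k2 [c [m mc] <-]]] kc.
have c0 : (0 < c)%N by case/andP: mc; lia.
have cn : (c %| window_start n + j)%N by rewrite (dvdn_trans _ kc) ?dvdn_mull.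
have c2 : (c * 2 <= window_start n + j)%N.
  apply: leq_trans (dvdn_leq _ kc); last lia.
  by rewrite mulnC leq_mul2r k2 orbT.
have [mn|nm] := ltnP m n.
  move/negP: jC; apply; apply/multiplesP; exists c; first by exists m.
  rewrite dvdn_addr // in cn; apply: dvdn_window_start mn _.
  by rewrite c0; case/andP: mc.
have nm' : (window_start n <= window_start m)%N.
  by move: nm; rewrite leq_eqVlt => /orP[/eqP->//|/window_start_lt]; lia.
by have := window_start_id n; case/andP: mc; lia.
Qed.

(** * Densities for the proper multiples of the windows *)

Theorem theorem4 (R : realType) :
  exists B : set nat,
    [/\ positive B,
        besicovitch R B,
        besicovitch R (tautification R B) &
        (0 < upper_banach_density R
               (multiples (tautification R B) `\` multiples B))%E].
Proof.
have C0 := windows_positive; have sC := windows_recip_summable R.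
exists (proper_multiples windows); split.
- exact: proper_multiples_positive.
- apply: (@besicovitch_approx R windows) => //.
    move=> z [_ [k _ [c Cc <-]] kz]; exists c => //=.
    by apply: dvdz_trans kz; rewrite dvdzE /= dvdn_mull.
  (* As [c < M <= i], the quotient [i / c] is at least 2 and [i] itself belongs to [B]. *)
  move=> M i c Cc cM Mi /dvdnP[k iE]; apply/multiplesP; exists i => //.
  exists k; last by exists c.
  by rewrite /=; case: k iE => [|[|k]]; lia.
- rewrite /besicovitch multiples_tautification //.
  apply: (@besicovitch_approx R windows) => // M i c Cc _ _ ci.
  by apply/multiplesP; exists c.
rewrite multiples_tautification //.
apply: lt_le_trans (_ : (2^-1%:E <= _)%E); first by rewrite lte_fin invr_gt0.
apply: upper_banach_density_ge => n n0; exists (window_start n)%:Z.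
have nR : 0 < n%:R :> R by rewrite ltr0n.
rewrite /window_mean ler_pdivlMr //.
(* Each [j] in [[1, n]] is in [M_C], or its translate is in the difference set. *)
have le1 : (n <= count_window (multiples windows `\`
    multiples (proper_multiples windows)) (window_start n) n +
    count_window (multiples windows) 0 n)%N.
  rewrite count_window0E /count_window -big_split /=.
  rewrite -[leqLHS](_ : (\sum_(1 <= i < n.+1) 1 = n)%N); last first.
    by rewrite sum_nat_const_nat muln1 subSS subn0.
  rewrite big_nat [leqRHS]big_nat; apply: leq_sum => i /andP[i0 iN].
  case: (boolP (i%:Z \in multiples windows)) => [|iC]; first by rewrite leq_addl.
  by rewrite -PoszD window_elt_notin // i0.
have le2 : (count_window (multiples windows) 0 n)%:R <= n%:R * 2^-1 :> R.
  (* The union bound over all of [C], with nothing truncated. *)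
  apply: (@le_trans _ _ ((count_window set0 0 n)%:R +
      n%:R * recip_sum R windows 0 n.+1)).
    apply: count_window_le => i _ /multiplesP[c Cc ci] _.
    by exists c.
  rewrite [count_window set0 _ _]big1 ?add0r; last by move=> i _; rewrite in_set0.
  by rewrite ler_pM2l // recip_sum_windows_half.
move: le1; rewrite -(ler_nat R) natrD => le1.
lra.
Qed.
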